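(* Let $\Bbbk$ be an $F$-finite field of characteristic $p>0$, let $\mathfrak{a}=\langle g_1,\ldots,g_m\rangle$ be an ideal of $\Bbbk[x]=\Bbbk[x_1,\ldots,x_n]$, let $z=z_1,\ldots,z_m$ be variables over $\Bbbk[x]$, and consider $G=z_1g_1+\cdots+z_mg_m$ as an element of $\Bbbk(z)[x]$, the polynomial ring in $x_1,\dots,x_n$ over the rational function field $\Bbbk(z)=\Bbbk(z_1,\ldots,z_m)$. If $t$ is a real number with $0<t<1$, then $\tau(G^t)=\mathfrak{a}^{[t]}\cdot\Bbbk(z)[x]$ and $\mathfrak{a}^{[t]}=\tau(G^t)\cap\Bbbk[x]$, where $\tau(G^t)$ is the test ideal of $G$ in $\Bbbk(z)[x]$. In particular, if $\mathfrak{a}$ is a nonzero proper ideal, then $\operatorname{fpt}(G)=\operatorname{lce}(\mathfrak{a})$.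
   Context: A ring $S$ of characteristic $p$ is $F$-finite if it is a finitely generated module over $S^p$; the definitions below apply to any $F$-finite regular domain $S$ of characteristic $p$ (such as $\Bbbk[x]$ and $\Bbbk(z)[x]$). Frobenius powers: let $q$ denote a power $p^e$, $e\ge 0$. For an ideal $\mathfrak{a}$ of $S$, $\mathfrak{a}^{[q]}=\langle f^q: f\in\mathfrak{a}\rangle$. For $k\in\mathbb{N}$ with base $p$ expansion $k=k_0+k_1p+\cdots+k_rp^r$, $\mathfrak{a}^{[k]}=\mathfrak{a}^{k_0}(\mathfrak{a}^{k_1})^{[p]}\cdots(\mathfrak{a}^{k_r})^{[p^r]}$ (with $\mathfrak{a}^0=S$). $\mathfrak{a}^{[1/q]}$ is the smallest ideal $\mathfrak{c}$ of $S$ with $\mathfrak{a}\subseteq\mathfrak{c}^{[q]}$, and $\mathfrak{a}^{[k/q]}=(\mathfrak{a}^{[k]})^{[1/q]}$ (well defined). For real $t\ge 0$ and $\mathfrak{a}$ nonzero, $\mathfrak{a}^{[t]}=\bigcup_k\mathfrak{a}^{[t_k]}$, where $(t_k)$ is any sequence of rational numbers with $p$-power denominators converging to $t$ monotonically from above, e.g. $t_k=\lceil p^kt\rceil/p^k$ (the union is of an ascending chain and independent of the sequence); also $\langle 0\rangle^{[t]}=\langle 0\rangle$ for $t>0$. Test ideals: for $t>0$, $\tau(\mathfrak{a}^t)=\bigcup_{e\ge 0}(\mathfrak{a}^{\lceil tp^e\rceil})^{[1/p^e]}$ (an ascending union), and $\tau(f^t)=\tau(\langle f\rangle^t)$ for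 $f\in S$. For a nonzero proper ideal $\mathfrak{a}$ of $S$: the least critical exponent is $\operatorname{lce}(\mathfrak{a})=\sup\{t>0:\mathfrak{a}^{[t]}=S\}=\min\{t>0:\mathfrak{a}^{[t]}\ne S\}$, and the $F$-pure threshold is $\operatorname{fpt}(\mathfrak{a})=\sup\{t>0:\tau(\mathfrak{a}^t)=S\}=\min\{t>0:\tau(\mathfrak{a}^t)\neq S\}$; $\operatorname{fpt}(f)=\operatorname{fpt}(\langle f\rangle)$. *)

(* Defs.v *)
From HB Require Import structures.
From mathcomp Require Import all_boot all_order all_algebra.
From mathcomp Require Import mpoly.
From mathcomp Require Import classical_sets reals.

Set Implicit Arguments.
Unset Strict Implicit.
Unset Printing Implicit Defensive.

Import Order.TTheory GRing.Theory Num.Theory.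
Local Open Scope classical_set_scope.
Local Open Scope ring_scope.

Section Ideals.
Context {S : comNzRingType}.
Implicit Types (a b I X : set S).

(* MathComp's idealr predicates are boolean and exclude the unit ideal; the
   ideals here are arbitrary subsets and may be the whole ring. *)
Definition is_ideal I : Prop :=
  [/\ I 0, (forall x y, I x -> I y -> I (x + y))
    & (forall r x, I x -> I (r * x))].

Definition ideal_gen X : set S :=
  [set x | forall I, is_ideal I -> X `<=` I -> I x].

Definition ideal_mul a b : set S :=
  ideal_gen [set z | exists x y, [/\ a x, b y & z = x * y]].

(* a^k, with a^0 the unit ideal. *)
Definition ideal_pow a (k : nat) : set S := iter k (ideal_mul a) setT.

(* a^[q] for q a power of the characteristic. *)
Definition frob a (q : nat) : set S := ideal_gen [set f ^+ q | f in a].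

(* a^[k] for k a natural number: the i-th factor comes from the i-th base p
   digit of k, and trunc_log p k is the index of the leading digit. *)
Definition frob_nat (p : nat) a (k : nat) : set S :=
  \big[ideal_mul/setT]_(i < (trunc_log p k).+1)
    frob (ideal_pow a ((k %/ p ^ i) %% p)) (p ^ i).

(* a^[1/q]: the intersection of all ideals c with a contained in c^[q], i.e.
   the smallest such ideal whenever a smallest one exists (as it does over an
   F-finite regular domain when q is a power of the characteristic). *)
Definition frob_root a (q : nat) : set S :=
  [set x | forall c, is_ideal c -> a `<=` frob c q -> c x].

End Ideals.

Definition F_finite (p : nat) (S : comNzRingType) : Prop :=
  exists (r : nat) (b : 'I_r -> S),
    forall x : S, exists c : 'I_r -> S, x = \sum_(i < r) c i ^+ p * b i.

Definition ext_ideal (S T : comNzRingType) (f : S -> T) (a : set S) : set T :=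
  ideal_gen (f @` a).

Section RealExponents.
Context {R : realType} {S : comNzRingType}.
Implicit Types (a : set S) (t : R).

(* The ceiling of t p^e, for t >= 0. *)
Definition ceil_scale (p : nat) t (e : nat) : nat :=
  `|Num.ceil (t * p%:R ^+ e)|%N.

(* a^[t], computed along t_e = ceil (t p^e) / p^e.  For a = 0 and t > 0 all
   these exponents are positive and the union is the zero ideal. *)
Definition frob_real (p : nat) a t : set S :=
  \bigcup_(e in [set: nat]) frob_root (frob_nat p a (ceil_scale p t e)) (p ^ e).

Definition test_ideal (p : nat) a t : set S :=
  \bigcup_(e in [set: nat]) frob_root (ideal_pow a (ceil_scale p t e)) (p ^ e).

End RealExponents.

(* For a nonzero proper ideal of an F-finite regular domain, the sets below are
   nonempty and bounded, so that sup does not take its default value 0. *)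
Definition lce (R : realType) (S : comNzRingType) (p : nat) (a : set S) : R :=
  sup [set t : R | 0 < t /\ frob_real p a t = setT].

Definition fpt (R : realType) (S : comNzRingType) (p : nat) (a : set S) : R :=
  sup [set t : R | 0 < t /\ test_ideal p a t = setT].

Section GenericCombination.
Variables (K : fieldType) (m n : nat).

(* K(z) = K(z_1, ..., z_m) *)
Definition ratfun : fieldType := {fraction {mpoly K[m]}}.

Definition ratfun_const (c : K) : ratfun := tofrac (c%:MP : {mpoly K[m]}).

Definition ratfun_var (i : 'I_m) : ratfun := tofrac ('X_i : {mpoly K[m]}).

(* The inclusion of K[x] into K(z)[x]. *)
Definition ratfun_ext (f : {mpoly K[n]}) : {mpoly ratfun[n]} :=
  map_mpoly ratfun_const f.

Definition generic_comb (g : 'I_m -> {mpoly K[n]}) : {mpoly ratfun[n]} :=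
  \sum_(i < m) ratfun_var i *: ratfun_ext (g i).

End GenericCombination.

Arguments ratfun_ext {K} m {n} f.

(* Main.v *)
(* Fix q = p^e and k < q, and let mu be a basis of K over K^q.  The elements
   mu_j x^w (all exponents < q) form a basis of K[x] over K[x]^q, and the
   mu_j z^v x^w form a basis of K(z)[x] over K(z)[x]^q.  If an ideal is generated
   by elements f_s, its q-th Frobenius root is generated by the h_(s,b) occurring
   in the expansions f_s = sum_b h_(s,b)^q b.  Now G^k = sum_v c_v z^v g^v, where
   the c_v are the coefficients of (X_1 + ... + X_m)^k, and a^[k] is generated by
   the g^v with c_v <> 0.  Since the c_v lie in the prime field they are q-th
   powers, and since k < q the z^v belong to the basis; hence <G^k> and a^[k]
   have roots with the same generators up to units, so that
   <G^k>^[1/q] = a^[k/q] K(z)[x].  For 0 < t < 1 the exponents ceil(t q)/q are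
   eventually < 1, which gives the first equality; contraction back to K[x] is
   by clearing denominators.  For t >= 1 both ideals are proper, so the two
   suprema range over the same set. *)

Require Import Defs.
From HB Require Import structures.
From mathcomp Require Import all_boot all_order all_algebra.
From mathcomp Require Import mpoly.
From mathcomp Require Import boolp classical_sets reals.

Set Implicit Arguments.
Unset Strict Implicit.
Unset Printing Implicit Defensive.

Import Order.TTheory GRing.Theory Num.Theory.
Local Open Scope classical_set_scope.
Local Open Scope ring_scope.

(** * Ideals as sets *)

Section IdealTheory.
Context {S : comNzRingType}.
Implicit Types (a b I X Y : set S).

Lemma ideal_gen_ideal X : is_ideal (ideal_gen X).
Proof.
split=> [I [] //|x y Xx Xy I idI XI|r x Xx I idI XI].
  by case: (idI) => _ D _; apply: D; [apply: Xx | apply: Xy].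
by case: (idI) => _ _ M; apply: M; apply: Xx.
Qed.

Lemma sub_ideal_gen X : X `<=` ideal_gen X.
Proof. by move=> x Xx I _; apply. Qed.

Lemma ideal_gen_min X I : is_ideal I -> X `<=` I -> ideal_gen X `<=` I.
Proof. by move=> idI XI x; apply. Qed.

Lemma ideal_gen_mono X Y : X `<=` Y -> ideal_gen X `<=` ideal_gen Y.
Proof.
move=> XY; apply: (ideal_gen_min (ideal_gen_ideal _)).
by apply: subset_trans XY (@sub_ideal_gen _).
Qed.

Lemma ideal_sum I (T : Type) (r : seq T) (P : pred T) (F : T -> S) :
  is_ideal I -> (forall i, P i -> I (F i)) -> I (\sum_(i <- r | P i) F i).
Proof. by case=> I0 ID _ IF; apply: big_ind. Qed.

Lemma ideal_mulr I x r : is_ideal I -> I x -> I (x * r).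
Proof. by case=> _ _ M Ix; rewrite mulrC; apply: M. Qed.

Lemma ideal_1 I : is_ideal I -> I 1 -> I = setT.
Proof.
case=> _ _ M I1; apply/seteqP; split=> // x _.
by rewrite -[x]mulr1; apply: M.
Qed.

Lemma setT_ideal : is_ideal [set: S].
Proof. by split. Qed.

Lemma ideal_gen1 : ideal_gen [set (1 : S)] = setT.
Proof. by apply: (ideal_1 (ideal_gen_ideal _)); apply: sub_ideal_gen. Qed.

(** Since [ideal_gen] is an intersection, a property of all generated elements is proved by
    exhibiting an ideal of elements that have it: here the ideal of y' with x' y' in J, then that of
    x' with x' y in J. *)
Lemma ideal_mul_gen X Y :
  ideal_mul (ideal_gen X) (ideal_gen Y) =
  ideal_gen [set z | exists x y, [/\ X x, Y y & z = x * y]].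
Proof.
apply/seteqP; split; last first.
  apply: ideal_gen_mono => _ [x [y [Xx Yy ->]]].
  by exists x, y; split=> //; apply: sub_ideal_gen.
set J := ideal_gen [set z | exists _, _].
have [J0 JD JM] : is_ideal J by exact: ideal_gen_ideal.
apply: ideal_gen_min => // _ [x [y [Xx Yy ->]]].
have JX x' : X x' -> J (x' * y).
  move=> Xx'; apply: (Yy [set y' | J (x' * y')]) => [|y' Yy'].
    split=> [|u v Ju Jv|r u Ju] /=; first by rewrite mulr0.
      by rewrite mulrDr; apply: JD.
    by rewrite mulrCA; apply: JM.
  by apply: sub_ideal_gen; exists x', y'.
apply: (Xx [set x' | J (x' * y)]) => // {x Xx}.
split=> [|u v Ju Jv|r u Ju] /=; first by rewrite mul0r.
  by rewrite mulrDl; apply: JD.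
by rewrite -mulrA; apply: JM.
Qed.

Lemma ideal_mul_ideal a b : is_ideal (ideal_mul a b).
Proof. exact: ideal_gen_ideal. Qed.

Lemma ideal_mul_subl a b : is_ideal a -> ideal_mul a b `<=` a.
Proof.
by move=> ida; apply: ideal_gen_min => // _ [x [y [ax _ ->]]]; apply: ideal_mulr.
Qed.

Lemma ideal_mul_subr a b : is_ideal b -> ideal_mul a b `<=` b.
Proof.
move=> idb; apply: ideal_gen_min => // _ [x [y [_ bx ->]]].
by case: idb => _ _; apply.
Qed.

Lemma ideal_pow_sub a k : is_ideal a -> (0 < k)%N -> ideal_pow a k `<=` a.
Proof. by move=> ida; case: k => // k _; apply: ideal_mul_subl. Qed.

Lemma ideal_pow_set1 (g : S) k :
  ideal_pow (ideal_gen [set g]) k = ideal_gen [set g ^+ k].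
Proof.
elim: k => [|k IHk]; first by rewrite expr0 ideal_gen1.
rewrite /ideal_pow iterS -/(ideal_pow _ k) IHk ideal_mul_gen.
congr ideal_gen; apply/seteqP; split=> [_ [_ [_ [-> -> ->]]]|_ ->] /=.
  by rewrite exprS.
by exists g, (g ^+ k); rewrite exprS.
Qed.

Lemma frob_ideal a q : is_ideal (frob a q).
Proof. exact: ideal_gen_ideal. Qed.

Lemma frob_mono a b q : a `<=` b -> frob a q `<=` frob b q.
Proof.
by move=> ab; apply: ideal_gen_mono => _ [x /ab bx <-]; exists x.
Qed.

Lemma mem_frob a q x : a x -> frob a q (x ^+ q).
Proof. by move=> ax; apply: sub_ideal_gen; exists x. Qed.

Lemma frob_le a q r : (q <= r)%N -> frob a r `<=` frob a q.
Proof.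
move=> qr; apply: (ideal_gen_min (frob_ideal _ _)) => _ [x ax <-].
by rewrite -(subnKC qr) exprD; apply: ideal_mulr (frob_ideal _ _) _; apply: mem_frob.
Qed.

Lemma frob_frob a q r : frob a (q * r) `<=` frob (frob a q) r.
Proof.
apply: (ideal_gen_min (frob_ideal _ _)) => _ [x ax <-].
by rewrite exprM; do 2!apply: mem_frob.
Qed.

(** Additivity of the q-th power makes the set of y with y^q in J an ideal; it contains X, hence all
    that X generates. *)
Lemma frob_gen q X : [pchar S].-nat q ->
  frob (ideal_gen X) q = ideal_gen [set f ^+ q | f in X].
Proof.
move=> hq; apply/seteqP; split; last first.
  by apply: ideal_gen_mono => _ [x Xx <-]; exists x => //; apply: sub_ideal_gen.
set J := ideal_gen [set _ | _ in X].
have [J0 JD JM] : is_ideal J by exact: ideal_gen_ideal.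
apply: ideal_gen_min => // _ [x Xx <-].
apply: (Xx [set y | J (y ^+ q)]) => [|y Xy]; last by apply: sub_ideal_gen; exists y.
have q0 : (0 < q)%N by case/andP: hq.
split=> [|u v Ju Jv|r u Ju] /=; first by rewrite expr0n gtn_eqF.
  by rewrite exprDn_pchar //; apply: JD.
by rewrite exprMn; apply: JM.
Qed.

Lemma frob_root_ideal a q : is_ideal (frob_root a q).
Proof.
split=> [c [] //|x y ax ay c idc ac|r x ax c idc ac].
  by case: (idc) => _ D _; apply: D; [apply: ax | apply: ay].
by case: (idc) => _ _ M; apply: M; apply: ax.
Qed.

Lemma frob_root_min a c q : is_ideal c -> a `<=` frob c q -> frob_root a q `<=` c.
Proof. by move=> idc ac x; apply. Qed.

End IdealTheory.

(** * Extension of ideals along a ring morphism *)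

Section Extension.
Context {S T : comNzRingType} (f : {rmorphism S -> T}).
Implicit Types (I : set S) (J : set T).

Lemma preimage_ideal J : is_ideal J -> is_ideal (f @^-1` J).
Proof.
case=> J0 JD JM; split=> [|u v Ju Jv|r u Ju] /=; first by rewrite rmorph0.
  by rewrite rmorphD; apply: JD.
by rewrite rmorphM; apply: JM.
Qed.

Lemma ext_ideal_gen (X : set S) : ext_ideal f (ideal_gen X) = ideal_gen (f @` X).
Proof.
apply/seteqP; split; last first.
  by apply: ideal_gen_mono => _ [x Xx <-]; exists x => //; apply: sub_ideal_gen.
apply: ideal_gen_min; first exact: ideal_gen_ideal.
move=> _ [x Xx <-].
set J := ideal_gen _.
have idJ : is_ideal J by exact: ideal_gen_ideal.
apply: (Xx (f @^-1` J)) => [|y Xy]; first exact: preimage_ideal.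
by apply: sub_ideal_gen; exists y.
Qed.

Lemma ext_ideal_mono I I' : I `<=` I' -> ext_ideal f I `<=` ext_ideal f I'.
Proof. by move=> sII'; apply: ideal_gen_mono => _ [x /sII' Ix <-]; exists x. Qed.

Lemma mem_ext_ideal I x : I x -> ext_ideal f I (f x).
Proof. by move=> Ix; apply: sub_ideal_gen; exists x. Qed.

Lemma ext_ideal_bigcup (E : Type) (D : set E) (I : E -> set S) :
  is_ideal (\bigcup_(e in D) ext_ideal f (I e)) ->
  ext_ideal f (\bigcup_(e in D) I e) = \bigcup_(e in D) ext_ideal f (I e).
Proof.
move=> idU; apply/seteqP; split.
  by apply: ideal_gen_min => // _ [x [e De Iex] <-]; exists e => //; apply: mem_ext_ideal.
by move=> y [e De]; apply: ext_ideal_mono => x Iex; exists e.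
Qed.

End Extension.

(** * Bases over the subring of q-th powers *)

(** Freeness of S over its q-th powers, with coefficients recorded by their q-th roots. Independence
    is required of the roots themselves, so that an expansion determines them when the q-th power is
    additive. *)
Definition frob_basis (S : comNzRingType) (q : nat) (I : finType) (b : I -> S) :=
  (forall x, exists c : I -> S, x = \sum_i c i ^+ q * b i) /\
  (forall c : I -> S, \sum_i c i ^+ q * b i = 0 -> forall i, c i = 0).

Section FrobBasis.
Context {S : comNzRingType} (q : nat).
Hypothesis hq : [pchar S].-nat q.

Lemma pchar_nat_gt0 : (0 < q)%N.
Proof. by case/andP: hq. Qed.

Lemma expr_pchar_sum (J : Type) (r : seq J) (P : pred J) (F : J -> S) :
  (\sum_(j <- r | P j) F j) ^+ q = \sum_(j <- r | P j) F j ^+ q.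
Proof.
apply: (big_morph (fun x => x ^+ q)) => [x y|]; first exact: exprDn_pchar.
by rewrite expr0n gtn_eqF // pchar_nat_gt0.
Qed.

Lemma exprB_pchar (x y : S) : (x - y) ^+ q = x ^+ q - y ^+ q.
Proof. by apply/eqP; rewrite eq_sym subr_eq -exprDn_pchar // subrK. Qed.

Context (I : finType) (b : I -> S).
Hypothesis hb : frob_basis q b.

Lemma frob_basis_inj (c d : I -> S) :
  \sum_i c i ^+ q * b i = \sum_i d i ^+ q * b i -> c =1 d.
Proof.
move=> eq_cd i; apply/eqP; rewrite -subr_eq0; apply/eqP.
apply: (hb.2 (fun i => c i - d i)).
under eq_bigr => j _ do rewrite exprB_pchar mulrBl.
by rewrite sumrB eq_cd subrr.
Qed.

(** The elements with all coordinates in c form an ideal J. It contains x^q for x in c, because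
    writing 1 = sum_i s_i^q b_i gives x^q the coordinates x s_i. Uniqueness of coordinates
    concludes. *)
Lemma frob_coord (c : set S) (h : I -> S) :
  is_ideal c -> frob c q (\sum_i h i ^+ q * b i) -> forall i, c (h i).
Proof.
move=> idc fh.
pose J := [set x | exists2 h, (forall i, c (h i)) & x = \sum_i h i ^+ q * b i].
have [c0 cD cM] := idc.
suff sJ : frob c q `<=` J.
  by have [h' ch' /frob_basis_inj eh] := sJ _ fh; move=> i; rewrite eh.
(* If r b_i has coordinates s_ij, the j-th coordinate of the product is sum_i h0_i s_ij, by
   additivity of the q-th power. *)
have MJ r h0 : (forall i, c (h0 i)) -> J (r * \sum_i h0 i ^+ q * b i).
  move=> ch.
  have /fin_all_exists[s sE] : forall i, exists s : I -> S,
    r * b i = \sum_j s j ^+ q * b j by move=> i; apply: hb.1.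
  exists (fun j => \sum_i h0 i * s i j).
    by move=> j; apply: ideal_sum => // i _; apply: ideal_mulr.
  rewrite mulr_sumr; under [RHS]eq_bigr => j _ do rewrite expr_pchar_sum mulr_suml.
  rewrite exchange_big /=; apply: eq_bigr => i _.
  rewrite mulrCA sE mulr_sumr; apply: eq_bigr => j _.
  by rewrite exprMn mulrA.
apply: ideal_gen_min => [|_ [x cx <-]].
  split=> [|_ _ [h1 ch1 ->] [h2 ch2 ->]|r _ [h1 ch1 ->]]; last exact: MJ.
    exists (fun=> 0) => //; rewrite big1 // => i _.
    by rewrite expr0n gtn_eqF ?pchar_nat_gt0 // mul0r.
  exists (fun i => h1 i + h2 i); first by move=> i; apply: cD.
  by rewrite -big_split; apply: eq_bigr => i _; rewrite exprDn_pchar // mulrDl.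
have [s sE] := hb.1 1.
have -> : x ^+ q = \sum_i (x * s i) ^+ q * b i.
  rewrite -[LHS]mulr1 sE mulr_sumr; apply: eq_bigr => i _.
  by rewrite exprMn mulrA.
by exists (fun i => x * s i) => // i; apply: ideal_mulr.
Qed.

(** The expansions put each F v in the q-th Frobenius power of the ideal generated by the h; by
    [frob_coord], any ideal with this property contains the h. So the intersection defining
    [frob_root] is here a genuine minimum. *)
Lemma frob_root_gen (V : Type) (A : set V) (F : V -> S) (h : V -> I -> S) :
  (forall v, A v -> F v = \sum_i h v i ^+ q * b i) ->
  frob_root (ideal_gen (F @` A)) q =
  ideal_gen [set x | exists v i, A v /\ x = h v i].
Proof.
move=> FE; apply/seteqP; split.
  apply: (frob_root_min (ideal_gen_ideal _)).
  apply: (ideal_gen_min (frob_ideal _ _)) => _ [v Av <-]; rewrite FE //.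
  set J := frob _ q; have idJ : is_ideal J by exact: frob_ideal.
  apply: (@ideal_sum _ J) => // i _; apply: (@ideal_mulr _ J) => //.
  by apply: mem_frob; apply: sub_ideal_gen; exists v, i.
apply: ideal_gen_min => [|_ [v [i [Av ->]]] c idc Fc]; first exact: frob_root_ideal.
have FvA : ideal_gen (F @` A) (F v) by apply: sub_ideal_gen; exists v.
by move: (Fc _ FvA); rewrite FE // => /frob_coord; apply.
Qed.

(* Writing 1 = sum_i s_i^q b_i, the coordinates of x^q are the x s_i, and the
   s_i generate the unit ideal. *)
Lemma frob_expr_mem (c : set S) x : is_ideal c -> frob c q (x ^+ q) -> c x.
Proof.
move=> idc; have [s sE] := hb.1 1.
have -> : x ^+ q = \sum_i (x * s i) ^+ q * b i.
  rewrite -[LHS]mulr1 sE mulr_sumr; apply: eq_bigr => i _.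
  by rewrite exprMn mulrA.
move=> /(frob_coord idc) cxs.
rewrite -[x]mulr1 sE mulr_sumr; apply: ideal_sum => // i _.
rewrite -(prednK pchar_nat_gt0) exprS mulrA mulrA -mulrA.
exact: ideal_mulr.
Qed.

End FrobBasis.

(** A spanning family of minimal size is free: a nontrivial relation would eliminate some b i0 and
    leave a shorter spanning family. *)
Lemma field_frob_basis (K : fieldType) (q : nat) : [pchar K].-nat q ->
  (exists (r : nat) (b : 'I_r -> K),
    forall x, exists c : 'I_r -> K, x = \sum_i c i ^+ q * b i) ->
  exists (r : nat) (b : 'I_r -> K), frob_basis q b.
Proof.
move=> hq.
pose spans r := `[< exists b : 'I_r -> K,
    forall x, exists c : 'I_r -> K, x = \sum_i c i ^+ q * b i >].
move=> [r0 [b0 span0]].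
have ex_r : exists r, spans r by exists r0; apply/asboolP; exists b0.
case: (ex_minnP ex_r) => r /asboolP[b span_b] min_r.
exists r, b; split=> // c c0 i0; apply: contrapT => /eqP ci0.
case: r => [|r] in b span_b min_r c i0 c0 ci0 *; first by case: (i0).
suff : spans r by move/min_r; rewrite ltnn.
apply/asboolP; exists (b \o lift i0) => x; have [d ->] := span_b x.
(* Coordinates after b i0 is replaced through the relation: a difference of two q-th powers is again
   a q-th power. *)
exists (fun i => d (lift i0 i) - d i0 * c (lift i0 i) / c i0).
have bi0 : b i0 = - \sum_(i < r) (c (lift i0 i) / c i0) ^+ q * b (lift i0 i).
  have c0q : c i0 ^+ q != 0 by rewrite expf_neq0.
  apply: (mulfI c0q); apply/eqP; rewrite mulrN -addr_eq0 mulr_sumr -{2}c0.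
  rewrite (bigD1_ord i0) //=; apply/eqP; congr (_ + _); apply: eq_bigr => i _.
  by rewrite mulrA -exprMn [c i0 * _]mulrC divfK.
rewrite (bigD1_ord i0) //= bi0 mulrN addrC mulr_sumr -sumrB; apply: eq_bigr => i _.
by rewrite exprB_pchar // mulrBl mulrA -exprMn mulrA.
Qed.

(** Spanning families compose: if the d_j span over p^e-th powers and the b_i over p-th powers, the
    d_j^p b_i span over p^(e+1)-th powers. Minimality then yields a basis. *)
Lemma F_finite_frob_basis (K : fieldType) (p e : nat) :
  p \in [pchar K] -> F_finite p K ->
  exists (r : nat) (b : 'I_r -> K), frob_basis (p ^ e) b.
Proof.
move=> hp [r [b span_b]].
have pnat k : [pchar K].-nat (p ^ k)%N.
  by rewrite pnatX pnatE ?hp ?(pcharf_prime hp).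
apply: field_frob_basis => //.
suff [I [d span_d]] : exists (I : finType) (d : I -> K),
    forall x, exists c : I -> K, x = \sum_i c i ^+ (p ^ e) * d i.
  exists #|I|, (d \o enum_val) => x; have [c ->] := span_d x.
  by exists (c \o enum_val); rewrite (reindex _ (onW_bij _ (@enum_val_bij I))).
elim: e => [|e [I [d span_d]]].
  by exists unit, (fun=> 1) => x; exists (fun=> x); rewrite big_const card_unit /= addr0 mulr1.
exists ('I_r * I)%type, (fun ij => d ij.2 ^+ p * b ij.1) => x.
have [c ->] := span_b x.
have /fin_all_exists[s sE] : forall i, exists s : I -> K,
    c i = \sum_j s j ^+ (p ^ e) * d j by move=> i; apply: span_d.
exists (fun ij => s ij.1 ij.2).
rewrite -(pair_big xpredT xpredT (fun i j => s i j ^+ (p ^ e.+1) * (d j ^+ p * b i))) /=.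
apply: eq_bigr => i _; rewrite {1}sE (expr_pchar_sum (pnat 1%N)) mulr_suml.
by apply: eq_bigr => j _; rewrite exprMn -exprM -expnSr mulrA.
Qed.

(** * Euclidean division of multinomial exponents by q *)

Section Multinomials.
Context {n q : nat}.
Implicit Types (m u v w : 'X_{1..n}).

(** Exponent vectors with entries below q are encoded as finite functions, so that they form a
    [finType] able to index a basis. *)
Definition mnm_of_ffun (f : {ffun 'I_n -> 'I_q}) : 'X_{1..n} :=
  [multinom (f i : nat) | i < n].

Definition mnm_divn m : 'X_{1..n} := [multinom (m i %/ q)%N | i < n].

Definition mnm_modn (q0 : (0 < q)%N) m : {ffun 'I_n -> 'I_q} :=
  [ffun i => Ordinal (ltn_pmod (m i) q0)].

Lemma mnm_divn_eq (q0 : (0 < q)%N) m :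
  m = (mnm_of_ffun (mnm_modn q0 m) + mnm_divn m *+ q)%MM.
Proof.
by apply/mnmP => i; rewrite mnmDE mulmnE !mnmE ffunE /= addnC -divn_eq.
Qed.

Lemma mnm_of_ffun_inj : injective mnm_of_ffun.
Proof.
move=> f g /mnmP fg; apply/ffunP => i; apply/val_inj.
by move: (fg i); rewrite !mnmE.
Qed.

Lemma eqm_divn u v w w' : (forall i, u i < q)%N -> (forall i, v i < q)%N ->
  ((u + w *+ q)%MM == (v + w' *+ q)%MM) = (u == v) && (w == w').
Proof.
move=> uq vq; apply/eqP/andP => [/mnmP eq_uv|[/eqP-> /eqP->] //].
have {}eq_uv i : (u i + w i * q = v i + w' i * q)%N.
  by move: (eq_uv i); rewrite !mnmDE !mulmnE.
split; apply/eqP/mnmP => i.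
  by move/(congr1 (modn^~ q)): (eq_uv i); rewrite ![(_ + _ * q)%N]addnC !modnMDl !modn_small.
have q0 : (0 < q)%N by apply: leq_ltn_trans (uq i).
move/(congr1 (divn^~ q)): (eq_uv i).
by rewrite ![(_ + _ * q)%N]addnC !divnMDl // !divn_small // !addn0.
Qed.

End Multinomials.

(** * Bases of polynomial rings over q-th powers *)

Section MPolyBasis.
Context {A : comNzRingType} (n q : nat).
Hypothesis hq : [pchar A].-nat q.
Implicit Types u v w : 'X_{1..n}.

Lemma pchar_mpoly : [pchar {mpoly A[n]}].-nat q.
Proof.
apply: sub_in_pnat hq => p _; exact: (rmorph_pchar (@mpolyC n A)).
Qed.

Let hqM := pchar_mpoly.

(** B^q has the terms B_w^q X^(q w), so the exponents v + q w of the product are told apart by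
    Euclidean division. *)
Lemma mcoeffMX_expr u v w (B : {mpoly A[n]}) :
  (forall i, v i < q)%N -> (forall i, u i < q)%N ->
  ('X_[v] * B ^+ q)@_(u + w *+ q) = (v == u)%:R * B@_w ^+ q.
Proof.
move=> vq uq; rewrite {1}[B]mpolyE (expr_pchar_sum hqM) mulr_sumr raddf_sum /=.
transitivity (\sum_(w' <- msupp B) (v == u)%:R * (B@_w' ^+ q * (w' == w)%:R)).
  apply: eq_bigr => w' _; rewrite exprZn mpolyXn -scalerAr -mpolyXD mcoeffZ mcoeffX.
  rewrite eqm_divn //; case: (v == u) => /=; last by rewrite mul0r mulr0.
  by rewrite mul1r.
rewrite -mulr_sumr; congr (_ * _).
have [wB|wB] := boolP (w \in msupp B).
  rewrite (bigD1_seq w) ?msupp_uniq //= eqxx mulr1 big1 ?addr0 // => w' /negPf->.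
  by rewrite mulr0.
rewrite (memN_msupp_eq0 wB) expr0n gtn_eqF ?(pchar_nat_gt0 hq) //.
rewrite big_seq big1 // => w' w'B; case: eqP => [ew|_]; last by rewrite mulr0.
by move: wB; rewrite -ew w'B.
Qed.

Lemma mcoeffM_expr u w (P B : {mpoly A[n]}) :
  (forall v, v \in msupp P -> forall i, v i < q)%N -> (forall i, u i < q)%N ->
  (P * B ^+ q)@_(u + w *+ q) = P@_u * B@_w ^+ q.
Proof.
move=> Pq uq; rewrite {1}[P]mpolyE mulr_suml raddf_sum /=.
rewrite [in RHS](mpolyE P) raddf_sum mulr_suml /=.
rewrite big_seq [RHS]big_seq; apply: eq_bigr => v vP.
rewrite -scalerAl !mcoeffZ mcoeffX mcoeffMX_expr ?mulrA //.
exact: Pq.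
Qed.

Lemma mpoly_frob_basis (I : finType) (b : I -> A) : frob_basis q b ->
  frob_basis q (fun jw : I * {ffun 'I_n -> 'I_q} =>
    (b jw.1)%:MP_[n] * 'X_[mnm_of_ffun jw.2]).
Proof.
have q0 : (0 < q)%N by exact: pchar_nat_gt0 hq.
move=> [span_b free_b]; split=> [x|c c0 [j w]].
  pose P x := exists c : I * {ffun 'I_n -> 'I_q} -> {mpoly A[n]},
    x = \sum_jw c jw ^+ q * ((b jw.1)%:MP_[n] * 'X_[mnm_of_ffun jw.2]).
  rewrite [x]mpolyE -/(P _); apply: (big_ind P) => [|_ _ [c ->] [d ->]|m _].
  - exists (fun=> 0); rewrite big1 // => jw _.
    by rewrite expr0n gtn_eqF ?mul0r.
  - exists (fun jw => c jw + d jw); rewrite -big_split; apply: eq_bigr => jw _.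
    by rewrite exprDn_pchar // mulrDl.
  (* X^m is X^(m mod q) times the q-th power of X^(m div q), so only the basis elements with
     monomial X^(m mod q) receive a coordinate. *)
  have [c ->] := span_b x@_m.
  exists (fun jw => if jw.2 == mnm_modn q0 m then c jw.1 *: 'X_[mnm_divn (q := q) m] else 0).
  rewrite -(pair_big xpredT xpredT (fun i (w : {ffun 'I_n -> 'I_q}) =>
    (if w == mnm_modn q0 m then c i *: 'X_[mnm_divn (q := q) m] else 0) ^+ q
       * ((b i)%:MP_[n] * 'X_[mnm_of_ffun w]))) /=.
  rewrite scaler_suml; apply: eq_bigr => i _.
  rewrite (bigD1 (mnm_modn q0 m)) //= eqxx big1 ?addr0 => [|w /negPf->]; last first.
    by rewrite expr0n gtn_eqF ?mul0r.
  rewrite {1}(mnm_divn_eq q0 m) addmC mpolyXD exprZn mpolyXn mul_mpolyC.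
  by rewrite -scalerAl -scalerAr scalerA.
(* The coefficient of the relation at w + q u involves only the c (j, w): it is a relation over A
   between their coefficients at u. *)
apply/mpolyP => u; rewrite mcoeff0.
apply: (free_b (fun j => (c (j, w))@_u)).
have wq i : (mnm_of_ffun w i < q)%N by rewrite mnmE.
have := congr1 (mcoeff (mnm_of_ffun w + u *+ q)) c0.
rewrite mcoeff0 raddf_sum /= => e0; rewrite -[RHS]e0.
transitivity (\sum_i \sum_(w' : {ffun 'I_n -> 'I_q})
    (c (i, w') ^+ q * ((b i)%:MP_[n] * 'X_[mnm_of_ffun w']))@_(mnm_of_ffun w + u *+ q)); last first.
  by rewrite pair_bigA; apply: eq_bigr => -[i' w'].
apply: eq_bigr => i _; rewrite (bigD1 w) //= big1 ?addr0 => [|w' /negPf neq_w].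
  by rewrite mulrCA mul_mpolyC mcoeffZ [_ ^+ q * 'X_[_]]mulrC mcoeffMX_expr // eqxx mul1r mulrC.
rewrite mulrCA mul_mpolyC mcoeffZ [_ ^+ q * 'X_[_]]mulrC mcoeffMX_expr //; last by move=> k; rewrite mnmE.
by rewrite (inj_eq mnm_of_ffun_inj) neq_w mul0r mulr0.
Qed.

End MPolyBasis.

(** * Common denominators and bases of fraction fields *)

Section Fractions.
Context {D : idomainType}.
Implicit Types (x : {fraction D}).

Lemma fraction_denom x : exists2 d : D, d != 0 & exists a, x * tofrac d = tofrac a.
Proof.
elim/quotW: x => r; exists \d_r; first exact: denom_ratioP.
exists \n_r; unlock tofrac; rewrite -[LHS]FracField.pi_mul; apply/eqmodP.
rewrite /= FracField.equivfE /FracField.mulf.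
have dr0 := denom_ratioP r.
by rewrite !numden_Ratio ?mulf_neq0 ?oner_eq0 // !mulr1 mulrC.
Qed.

Lemma fraction_common_denom (I : finType) (c : I -> {fraction D}) :
  exists2 d : D, d != 0 & exists a : I -> D, forall i, c i * tofrac d = tofrac (a i).
Proof.
have /fin_all_exists[d dP] : forall i, exists d : D,
    d != 0 /\ exists a, c i * tofrac d = tofrac a.
  by move=> i; have [d d0 ad] := fraction_denom (c i); exists d.
exists (\prod_i d i); first by apply/prodf_neq0 => i _; case: (dP i).
suff /fin_all_exists[a aE] : forall i, exists a : D,
    c i * tofrac (\prod_j d j) = tofrac a by exists a.
move=> i; have [_ [a aE]] := dP i.
exists (a * \prod_(j | j != i) d j).
by rewrite (bigD1 i) //= !tofracM mulrA aE.
Qed.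

(** Since a / d = a d^(q-1) / d^q, it suffices to expand the numerator in D. A relation descends to
    D after multiplication by the q-th power of a common denominator. *)
Lemma fraction_frob_basis (q : nat) (I : finType) (b : I -> D) :
  [pchar D].-nat q -> frob_basis q b ->
  frob_basis q (fun i => tofrac (b i) : {fraction D}).
Proof.
move=> hq [span_b free_b]; have q0 := pchar_nat_gt0 hq; split=> [x|c c0 i].
  have [d d0 [a ad]] := fraction_denom x.
  have [c cE] := span_b (a * d ^+ q.-1).
  have d0' : tofrac d != 0 by rewrite tofrac_eq0.
  exists (fun i => tofrac (c i) / tofrac d).
  have -> : x = tofrac (a * d ^+ q.-1) / tofrac d ^+ q.
    rewrite tofracM (tofracXn q.-1 d) -ad -[X in X / _]mulrA -exprS prednK // mulfK //.
    by rewrite expf_neq0.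
  rewrite cE raddf_sum mulr_suml; apply: eq_bigr => i _ /=.
  by rewrite tofracM tofracXn expr_div_n mulrAC.
have [d d0 [a ad]] := fraction_common_denom c.
have a0 : \sum_i a i ^+ q * b i = 0.
  apply/eqP; rewrite -tofrac_eq0; apply/eqP.
  transitivity (tofrac d ^+ q * (\sum_i c i ^+ q * tofrac (b i))).
    rewrite raddf_sum mulr_sumr.
    apply: eq_bigr => j _ /=.
    by rewrite tofracM tofracXn -ad exprMn -mulrA mulrCA.
  by rewrite c0 mulr0.
have := ad i; rewrite (free_b _ a0) tofrac0 => /eqP.
by rewrite mulf_eq0 tofrac_eq0 (negPf d0) orbF => /eqP.
Qed.

End Fractions.

(** * Powers of X_1 + ... + X_m and Frobenius powers of ideals *)

(** Membership of v in the support of [sumX K m ^+ k] expresses that v has degree k and that its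
    multinomial coefficient is nonzero in K. *)
Definition sumX (K : nzRingType) (m : nat) : {mpoly K[m]} := \sum_(i < m) 'X_i.
Arguments sumX : clear implicits.

Lemma mnm_le_mdeg m (u : 'X_{1..m}) i : (u i <= mdeg u)%N.
Proof. by rewrite mdegE (bigD1 i) //= leq_addr. Qed.

Section PowerOfSum.
Context {K : fieldType} (m p : nat).
Hypothesis hp : p \in [pchar K].

Let p_pr : prime p := pcharf_prime hp.

Lemma pchar_expn e : [pchar K].-nat (p ^ e)%N.
Proof. by rewrite pnatX pnatE ?hp. Qed.

Lemma mdeg_msupp_sumX k v : v \in msupp (sumX K m ^+ k) -> mdeg v = k.
Proof.
suff /(dhomogMn k) : sumX K m \is 1.-homog by rewrite mul1n => /dhomogP; apply.
by apply: rpred_sum => i _; rewrite dhomogX /= mdeg1.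
Qed.

(** Applying Frobenius to the coefficients fixes X_1 + ... + X_m, hence its powers. *)
Lemma sumX_coef_frob k v e : (sumX K m ^+ k)@_v ^+ (p ^ e) = (sumX K m ^+ k)@_v.
Proof.
elim: e => [|e IHe]; first by rewrite expr1.
rewrite expnSr exprM IHe -[LHS](pFrobenius_autE hp) -mcoeff_map_mpoly rmorphXn.
congr (mcoeff v (_ ^+ k)); rewrite raddf_sum; apply: eq_bigr => i _ /=.
by rewrite map_mpolyX.
Qed.

(** Differentiating in a variable that divides X^u relates the coefficient at u to k times a
    coefficient of the previous power, and a positive k < p is invertible in K. *)
Lemma sumX_coef_neq0 k u : (k < p)%N -> mdeg u = k -> (sumX K m ^+ k)@_u != 0.
Proof.
elim: k u => [|k IHk] u ltkp du.
  by move/eqP: du; rewrite mdeg_eq0 => /eqP->; rewrite expr0 mcoeff1 eqxx oner_eq0.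
have [i ui] : exists i, u i != 0%N.
  have : mdeg u != 0%N by rewrite du.
  by rewrite mdegE sum_nat_eq0 => /forallPn[i]; exists i.
have uE : u = (u - U_(i) + U_(i))%MM by rewrite submK // lep1mP.
have dX j : (mderiv i (sumX K m ^+ j) = sumX K m ^+ j.-1 *+ j).
  elim: j => [|j IHj]; first by rewrite expr0 mulr0n -mpolyC1 mderivC.
  rewrite exprS mderivM IHj /= mulrnAr.
  have -> : mderiv i (sumX K m) = 1.
    rewrite raddf_sum (bigD1 i) //= big1 ?addr0 => [|j' /negPf nij].
      by rewrite mderivX mnm1E eqxx scale1r -{1}[U_(i)%MM]add0m addmK mpolyX0.
    by rewrite mderivX mnm1E nij scale0r.
  case: j {IHj} => [|j]; first by rewrite mulr0n mul1r addr0.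
  by rewrite mul1r -exprS -mulrS.
have := mcoeff_deriv i (u - U_(i))%MM (sumX K m ^+ k.+1).
rewrite dX -uE mcoeffMn /= => eq_c; apply/eqP => c0.
move: eq_c; rewrite c0 mul0rn => /eqP; rewrite -mulr_natr mulf_eq0 => /orP[].
  apply/negP/IHk; first exact: ltnW.
  by move/(congr1 mdeg): uE; rewrite mdegD mdeg1 du addn1 => -[].
by rewrite -(dvdn_pcharf hp) gtnNdvd.
Qed.

Context {S : comNzRingType} (g : 'I_m -> S).
Hypothesis hpS : p \in [pchar S].

Lemma mmap1D u v : mmap1 g (u + v)%MM = mmap1 g u * mmap1 g v.
Proof. by apply: commr_mmap1_M => i x; apply: mulrC. Qed.

Lemma mmap1Mn u k : mmap1 g (u *+ k)%MM = mmap1 g u ^+ k.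
Proof.
by rewrite /mmap1 -prodrXl; apply: eq_bigr => i _; rewrite mulmnE exprM.
Qed.

Lemma ideal_pow_range k :
  ideal_pow (ideal_gen (range g)) k = ideal_gen (mmap1 g @` [set u | mdeg u = k]).
Proof.
elim: k => [|k IHk].
  rewrite /= -ideal_gen1; congr ideal_gen; apply/seteqP; split=> [_ ->|_ [u /eqP + <-]] /=.
    by exists 0%MM; rewrite ?mdeg0 ?mmap11.
  by rewrite mdeg_eq0 => /eqP->; rewrite mmap11.
rewrite /ideal_pow iterS -/(ideal_pow _ k) IHk ideal_mul_gen.
congr ideal_gen; apply/seteqP; split=> [_ [_ [_ [[i _ <-] [u du <-] ->]]]|_ [u /= du <-]] /=.
  by exists (U_(i) + u)%MM; rewrite ?mdegD ?mdeg1 ?du // mmap1D mmap1U.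
have [i ui] : exists i, u i != 0%N.
  have : mdeg u != 0%N by rewrite du.
  by rewrite mdegE sum_nat_eq0 => /forallPn[i]; exists i.
have uE : u = (u - U_(i) + U_(i))%MM by rewrite submK // lep1mP.
exists (g i), (mmap1 g (u - U_(i))%MM); split; first by exists i.
  exists (u - U_(i))%MM => //=.
  by move/(congr1 mdeg): uE; rewrite mdegD mdeg1 du addn1 => -[].
by rewrite {1}uE mmap1D mmap1U mulrC.
Qed.

(** One digit of a Lucas-type criterion: the power factors as sumX^k0 (sumX^k1)^p, the exponent
    splits uniquely modulo p, and below p every monomial of degree k0 occurs. *)
Lemma msupp_sumX_expr k0 k1 (u w : 'X_{1..m}) : (k0 < p)%N -> (forall i, u i < p)%N ->
  ((u + w *+ p)%MM \in msupp (sumX K m ^+ (k0 + p * k1))) =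
  (mdeg u == k0) && (w \in msupp (sumX K m ^+ k1)).
Proof.
move=> k0p up; rewrite mcoeff_msupp exprD mulnC exprM.
rewrite (@mcoeffM_expr K m p (pchar_expn 1)) //; last first.
  move=> v /mdeg_msupp_sumX dv i; apply: leq_ltn_trans k0p.
  by rewrite -dv mnm_le_mdeg.
rewrite mulf_eq0 negb_or expf_eq0 (prime_gt0 p_pr) /= -!mcoeff_msupp.
congr (_ && _); apply/idP/eqP => [|du]; first exact: mdeg_msupp_sumX.
by rewrite mcoeff_msupp sumX_coef_neq0.
Qed.

Lemma modn_expS k N : (k %% p ^ N.+1 = k %% p + p * ((k %/ p) %% p ^ N))%N.
Proof.
have p0 := prime_gt0 p_pr.
rewrite {1}(divn_eq k p) {1}(divn_eq (k %/ p) (p ^ N)) mulnDl -mulnA -expnSr.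
rewrite -addnA modnMDl modn_small; first by rewrite addnC [(_ * p)%N]mulnC.
rewrite addnC; apply: (@leq_trans (p + (k %/ p %% p ^ N) * p)).
  by rewrite ltn_add2r ltn_pmod.
by rewrite -mulSn expnSr leq_mul2r ltn_mod expn_gt0 p0 orbT.
Qed.

(** The shift s makes the induction work: removing the lowest digit of k raises the Frobenius
    exponent of all remaining factors by one. *)
Lemma big_frob_range N s k :
  \big[ideal_mul/setT]_(i < N)
    frob (ideal_pow (ideal_gen (range g)) ((k %/ p ^ i) %% p)) (p ^ (s + i)) =
  ideal_gen [set mmap1 g v ^+ (p ^ s) |
              v in [set v | v \in msupp (sumX K m ^+ (k %% p ^ N))]].
Proof.
elim: N s k => [|N IHN] s k.
  rewrite big_ord0 modn1 expr0 -ideal_gen1; congr ideal_gen.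
  apply/seteqP; split=> [_ ->|_ [v /= + <-]].
    by exists 0%MM; rewrite /= ?mcoeff_msupp ?mcoeff1 ?eqxx ?oner_eq0 // mmap11 expr1n.
  rewrite mcoeff_msupp mcoeff1; have [-> _|_] := eqVneq v 0%MM; last by rewrite eqxx.
  by rewrite mmap11 expr1n.
have pS e : [pchar S].-nat (p ^ e)%N by rewrite pnatX pnatE ?hpS.
rewrite big_ord_recl divn1 addn0 ideal_pow_range frob_gen //.
under eq_bigr => i _ do rewrite lift0 addnS -addSn expnS divnMA.
rewrite IHN ideal_mul_gen modn_expS; congr ideal_gen; apply/seteqP; split.
  move=> _ [_ [_ [[_ [u /= du <-] <-] [w /= wE <-] ->]]].
  exists (u + w *+ p)%MM => /=.
    rewrite msupp_sumX_expr ?ltn_pmod ?prime_gt0 ?du ?eqxx // => i.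
    by apply: leq_ltn_trans (mnm_le_mdeg u i) _; rewrite du ltn_pmod ?prime_gt0.
  by rewrite mmap1D mmap1Mn exprMn -exprM -expnS.
have p0 := prime_gt0 p_pr.
move=> _ [v /= + <-]; rewrite (mnm_divn_eq p0 v).
set u := mnm_of_ffun _; set w := mnm_divn v.
rewrite msupp_sumX_expr ?ltn_pmod //; last by move=> i; rewrite mnmE.
case/andP=> /eqP du wE; exists (mmap1 g u ^+ (p ^ s)), (mmap1 g w ^+ (p ^ s.+1)).
split; [by exists (mmap1 g u) => //; exists u | by exists w |].
by rewrite mmap1D mmap1Mn exprMn -exprM -expnS.
Qed.

Lemma frob_nat_range k :
  frob_nat p (ideal_gen (range g)) k =
  ideal_gen (mmap1 g @` [set v | v \in msupp (sumX K m ^+ k)]).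
Proof.
have := big_frob_range (trunc_log p k).+1 0 k; rewrite /frob_nat => ->.
by rewrite modn_small ?trunc_log_ltn ?prime_gt1 // expn0.
Qed.

(** With [frob_nat_range] this puts g_i^k in a^[k]. Both k and the exponent are peeled digit by
    digit. *)
Lemma sumX_pure_power i k : (U_(i) *+ k)%MM \in msupp (sumX K m ^+ k).
Proof.
have pP := prime_gt1 p_pr; elim/ltn_ind: k => -[_|k IHk].
  by rewrite mulm0n mcoeff_msupp expr0 mcoeff1 eqxx oner_eq0.
rewrite (divn_eq k.+1 p) addnC mulnC.
have -> : (U_(i) *+ (k.+1 %% p + p * (k.+1 %/ p)) =
    U_(i) *+ (k.+1 %% p) + (U_(i) *+ (k.+1 %/ p)) *+ p :> 'X_{1..m})%MM.
  by apply/mnmP => l; rewrite mnmDE !mulmnE mulnDr mulnA mulnAC.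
have k0p : (k.+1 %% p < p)%N by rewrite ltn_pmod // ltnW.
rewrite msupp_sumX_expr //; last first.
  by move=> l; rewrite mulmnE mnm1E; apply: leq_ltn_trans k0p; case: (_ == _); rewrite ?mul1n.
by rewrite mdegMn mdeg1 mul1n eqxx IHk // ltn_Pdiv.
Qed.

End PowerOfSum.

(** * Chains of Frobenius roots *)

Lemma bigcup_ideal (S : comNzRingType) (I : nat -> set S) :
  (forall e, is_ideal (I e)) -> (forall e, I e `<=` I e.+1) ->
  is_ideal (\bigcup_(e in [set: nat]) I e).
Proof.
move=> idI incI; have monoI d e : (d <= e)%N -> I d `<=` I e.
  move=> /subnKC <-; elim: (e - d)%N => [|l IHl]; first by rewrite addn0.
  by rewrite addnS; apply: subset_trans (incI _).
split.
- by exists 0%N => //; case: (idI 0%N).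
- move=> x y [d _ Ix] [e _ Iy]; exists (maxn d e) => //; case: (idI (maxn d e)) => _ ID _.
  by apply: ID; [apply: monoI Ix; rewrite leq_maxl|apply: monoI Iy; rewrite leq_maxr].
- by move=> r x [e _ Ix]; exists e => //; case: (idI e) => _ _; apply.
Qed.

Lemma big_ideal_mul_ideal (S : comNzRingType) (N : nat) (I : 'I_N -> set S) :
  is_ideal (\big[ideal_mul/setT]_(i < N) I i).
Proof.
case: N I => [|N] I; first by rewrite big_ord0; exact: setT_ideal.
by rewrite big_ord_recl; exact: ideal_mul_ideal.
Qed.

Lemma big_ideal_mul_sub (S : comNzRingType) (N : nat) (I : 'I_N -> set S) i :
  (forall i, is_ideal (I i)) -> \big[ideal_mul/setT]_(i < N) I i `<=` I i.
Proof.
elim: N => [|N IHN] in I i *; first by case: i.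
move=> idI; rewrite big_ord_recl.
have [->|] := eqVneq i ord0; first exact: (ideal_mul_subl (idI ord0)).
rewrite eq_sym => /unlift_some[i' -> _].
apply: subset_trans (IHN (fun i => I (lift ord0 i)) i' _) => //.
exact: ideal_mul_subr (big_ideal_mul_ideal _).
Qed.

(** The factor of the leading digit suffices: that digit is nonzero and its index l is at least e,
    so the factor lies in a^[p^l], hence in a^[p^e]. *)
Lemma frob_nat_sub (S : comNzRingType) (p e k : nat) (a : set S) :
  (1 < p)%N -> is_ideal a -> (p ^ e <= k)%N -> frob_nat p a k `<=` frob a (p ^ e).
Proof.
move=> p1 ida lek; have p0 := ltnW p1.
have k0 : (0 < k)%N by apply: leq_trans lek; rewrite expn_gt0 p0.
pose l := trunc_log p k.
apply: subset_trans (big_ideal_mul_sub ord_max (fun i => frob_ideal _ _)) _.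
apply: (@subset_trans _ (frob a (p ^ l))).
  apply: frob_mono; apply: ideal_pow_sub => //=.
  rewrite modn_small; first by rewrite divn_gt0 ?expn_gt0 ?p0 // trunc_logP.
  by rewrite ltn_divLR ?expn_gt0 ?p0 // -expnS trunc_log_ltn.
by apply: frob_le; rewrite leq_pexp2l // trunc_log_max.
Qed.

(** If f^k' lies in c^[p^(e+1)], so does (f^k)^p; extracting a p-th root puts f^k in c^[p^e]. This
    makes the chain defining the test ideal ascend. *)
Lemma frob_root_pow_step (S : comNzRingType) (p e k k' : nat) (f : S)
    (I : finType) (b : I -> S) :
  [pchar S].-nat p -> frob_basis p b -> (k' <= p * k)%N ->
  frob_root (ideal_pow (ideal_gen [set f]) k) (p ^ e) `<=`
  frob_root (ideal_pow (ideal_gen [set f]) k') (p ^ e.+1).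
Proof.
move=> hp hb lek x; rewrite !ideal_pow_set1 => fx c idc fc; apply: fx => //.
apply: ideal_gen_min => [|_ ->]; first exact: frob_ideal.
apply: (frob_expr_mem hp hb); first exact: frob_ideal.
apply: frob_frob; rewrite -expnSr -exprM mulnC -(subnK lek) exprD.
have [_ _ M] := frob_ideal c (p ^ e.+1); apply: M.
by apply: fc; apply: sub_ideal_gen.
Qed.

(** * Ceilings of t p^e *)

Section CeilScale.
Variables (R : realType) (p : nat) (t : R).
Hypotheses (p1 : (1 < p)%N) (t0 : 0 < t).

Lemma ceil_scale_le e N : (ceil_scale p t e <= N)%N = (t * p%:R ^+ e <= N%:R).
Proof.
have x0 : 0 <= t * p%:R ^+ e by rewrite mulr_ge0 ?exprn_ge0 ?ler0n // ltW.
have c0 : 0 <= Num.ceil (t * p%:R ^+ e) by rewrite ceil_ge0 (lt_le_trans _ x0) // ltrN10.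
by rewrite -lez_nat /ceil_scale gez0_abs // ceil_le_int.
Qed.

Lemma ceil_scaleS e : (ceil_scale p t e.+1 <= p * ceil_scale p t e)%N.
Proof.
rewrite ceil_scale_le exprSr mulrA natrM mulrC ler_wpM2l ?ler0n //.
by rewrite -ceil_scale_le.
Qed.

Lemma ceil_scale_lt e : (ceil_scale p t e < p ^ e)%N = (t * p%:R ^+ e <= p%:R ^+ e - 1).
Proof.
have q0 : (0 < p ^ e)%N by rewrite expn_gt0 ltnW.
have qE : p%:R ^+ e = (p ^ e).-1%:R + 1 :> R.
  by rewrite -natrX -[in LHS](ltn_predK q0) -addn1 natrD.
rewrite -(ltn_predK q0) ltnS ceil_scale_le; congr (_ <= _).
by rewrite qE addrK.
Qed.

Lemma ceil_scale_ge e : 1 <= t -> (p ^ e <= ceil_scale p t e)%N.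
Proof.
move=> t1; rewrite leqNgt ceil_scale_lt -ltNge.
have q0 : 0 < p%:R ^+ e :> R by rewrite exprn_gt0 // ltr0n ltnW.
by apply: lt_le_trans (_ : p%:R ^+ e <= _); rewrite ?gtrBl // ler_peMl // ltW.
Qed.

(** The inequality amounts to 1 - t >= p^(-e), and the Archimedean bound e of 1 / (1 - t) satisfies
    1 / (1 - t) < e < p^e. *)
Lemma ceil_scale_lt_ex : t < 1 -> exists e, (ceil_scale p t e < p ^ e)%N.
Proof.
move=> t1; have t1' : 0 < 1 - t by rewrite subr_gt0.
have i0 : 0 <= (1 - t)^-1 by rewrite invr_ge0 ltW.
exists (Num.Def.archi_bound (1 - t)^-1); set e := Num.Def.archi_bound _.
rewrite ceil_scale_lt lerBrDr -lerBrDl -{1}[p%:R ^+ e]mul1r -mulrBl.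
rewrite -ler_pdivrMl // mulr1; apply: (le_trans (ltW (archi_boundP i0))).
by rewrite -natrX ler_nat ltnW // ltn_expl.
Qed.

End CeilScale.

(** * Contraction and the generic linear combination *)

(* Elements of the extension have a common denominator in W, and sw exposes the
   components in which membership in I can be tested. *)
Lemma ext_ideal_contract_gen (A B C T : comNzRingType) (al : {rmorphism A -> B})
    (io : {rmorphism B -> C}) (sw : {rmorphism B -> T}) (W : set B)
    (I : set A) (J : set T) (f : A) :
  injective io -> W 1 -> (forall d e, W d -> W e -> W (d * e)) ->
  (forall r, exists2 d, W d & exists r', io d * r = io r') ->
  is_ideal J -> (forall h, I h -> J (sw (al h))) ->
  (forall d, W d -> J (sw (d * al f)) -> I f) ->
  ext_ideal (io \o al) I (io (al f)) -> I f.
Proof.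
move=> io_inj W1 WM denom [J0 JD JM] IJ JI.
pose L := [set t : C | exists2 d, W d & exists2 t', io d * t = io t' & J (sw t')].
have idL : is_ideal L.
  split.
  - by exists 1 => //; exists 0; rewrite ?mulr0 rmorph0.
  - move=> x y [d Wd [x' dx Jx]] [e We [y' ey Jy]].
    exists (d * e); first exact: WM.
    exists (e * x' + d * y').
      by rewrite rmorphD !rmorphM -dx -ey mulrDr !mulrA [io e * _]mulrC.
    by rewrite rmorphD !rmorphM; apply: JD; apply: JM.
  - move=> r x [d Wd [x' dx Jx]]; have [e We [r' er]] := denom r.
    exists (e * d); first exact: WM.
    exists (r' * x'); last by rewrite rmorphM; apply: JM.
    by rewrite !rmorphM -er -dx mulrACA.
have sL : ext_ideal (io \o al) I `<=` L.
  apply: ideal_gen_min => // _ [h Ih <-]; exists 1 => //.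
  by exists (al h); [rewrite rmorph1 mul1r | apply: IJ].
move=> /sL[d Wd [t' dt Jt]]; apply: (JI d) => //.
by rewrite (_ : d * al f = t') //; apply: io_inj; rewrite rmorphM.
Qed.

(** This is the extension of I to the polynomial ring, described by coefficients. *)
Lemma coef_ideal (S : comNzRingType) (m : nat) (I : set S) : is_ideal I ->
  is_ideal [set s : {mpoly S[m]} | forall v, I s@_v].
Proof.
move=> idI; have [I0 ID IM] := idI; split=> [v|s t Is It v|r s Is v].
- by rewrite mcoeff0.
- by rewrite mcoeffD; apply: ID.
- by rewrite mcoeffM; apply: ideal_sum => // k _; apply: IM.
Qed.

Lemma mpoly_common_denom (D : idomainType) (F : fieldType) (j : {rmorphism D -> F})
    (n : nat) :
  (forall x, exists2 d, d != 0 & exists a, x * j d = j a) ->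
  forall r : {mpoly F[n]}, exists2 d, d != 0 & exists r', j d *: r = map_mpoly j r'.
Proof.
move=> denom r.
pose P r := exists2 d, d != 0 & exists r' : {mpoly D[n]}, j d *: r = map_mpoly j r'.
rewrite -/(P r) [r]mpolyE; apply: (big_ind P) => [|x y [d d0 [x' dx]] [e e0 [y' ey]]|u _].
- by exists 1; [exact: oner_neq0|exists 0; rewrite scaler0 raddf0].
- exists (d * e); first by rewrite mulf_neq0.
  exists (e *: x' + d *: y'); rewrite rmorphD /= !map_mpolyZ -dx -ey.
  by rewrite scalerDr !scalerA -!rmorphM [e * d]mulrC.
have [d d0 [a ad]] := denom r@_u.
exists d => //; exists (a *: 'X_[u]).
by rewrite map_mpolyZ map_mpolyX scalerA mulrC ad.
Qed.

Lemma mpoly_sum_ffun (A : nzRingType) (n q : nat) (P : {mpoly A[n]}) :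
  (forall v, v \in msupp P -> forall i, v i < q)%N ->
  P = \sum_(f : {ffun 'I_n -> 'I_q}) P@_(mnm_of_ffun f) *: 'X_[mnm_of_ffun f].
Proof.
move=> Pq; apply/mpolyP => u; rewrite raddf_sum /=.
under eq_bigr => f _ do rewrite mcoeffZ mcoeffX.
have [uP|uP] := boolP (u \in msupp P); last first.
  rewrite (memN_msupp_eq0 uP) big1 // => f _.
  by case: eqP => [->|_]; rewrite ?mulr0 // (memN_msupp_eq0 uP) mul0r.
pose f0 : {ffun 'I_n -> 'I_q} := [ffun i => Ordinal (Pq u uP i)].
have f0E : mnm_of_ffun f0 = u by apply/mnmP => i; rewrite mnmE ffunE.
rewrite (bigD1 f0) //= f0E eqxx mulr1 big1 ?addr0 // => f.
by rewrite -f0E (inj_eq mnm_of_ffun_inj) => /negPf->; rewrite mulr0.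
Qed.

Section GenericField.
(* F stands for the fraction field of K[z_1, ..., z_m]; only the properties
   [denom] and [hF] below are used. *)
Variables (K : fieldType) (m n : nat) (F : fieldType).
Variable j : {rmorphism {mpoly K[m]} -> F}.
Local Notation D := {mpoly K[m]}.
Local Notation ext := (map_mpoly (n := n) (j \o @mpolyC m K)).

Section Contraction.
Hypothesis j_inj : injective j.
Hypothesis denom : forall x, exists2 d, d != 0 & exists a, x * j d = j a.

(** Reading K[z][x] as K[x][z] lets an ideal of K[x] be tested on the coefficients of the monomials
    in z. *)
Lemma mpoly_swap : exists f : {rmorphism {mpoly D[n]} -> {mpoly {mpoly K[n]}[m]}},
  (forall d : D, f d%:MP = map_mpoly (@mpolyC n K) d) /\
  (forall h : {mpoly K[n]}, f (map_mpoly (@mpolyC m K) h) = h%:MP).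
Proof.
exists (mmap (map_mpoly (@mpolyC n K)) (fun i => ('X_i)%:MP_[m])).
split=> [d|h]; first exact: mmapC.
pose f := mmap (map_mpoly (@mpolyC n K)) (fun i => ('X_i : {mpoly K[n]})%:MP_[m]).
pose P (h : {mpoly K[n]}) := f (map_mpoly (@mpolyC m K) h) = h%:MP_[m].
rewrite -/(P h) [h]mpolyE; apply: (big_ind P) => [|x y Px Py|u _]; rewrite /P.
- by rewrite /f !rmorph0.
- have -> : map_mpoly (@mpolyC m K) (x + y) =
      map_mpoly (@mpolyC m K) x + map_mpoly (@mpolyC m K) y by exact: raddfD.
  have -> : f (map_mpoly (@mpolyC m K) x + map_mpoly (@mpolyC m K) y) =
      f (map_mpoly (@mpolyC m K) x) + f (map_mpoly (@mpolyC m K) y).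
    exact: raddfD.
  by rewrite mpolyCD; exact: (congr2 +%R Px Py).
rewrite map_mpolyZ map_mpolyX /f mmapZ mmapX /= map_mpolyC.
rewrite -mul_mpolyC mpolyCM; congr (_ * _).
by rewrite mpolyXE_id /mmap1 rmorph_prod; apply: eq_bigr => i _; rewrite rmorphXn.
Qed.

Lemma ext_ideal_contract (I : set {mpoly K[n]}) f : is_ideal I ->
  ext_ideal ext I (ext f) -> I f.
Proof.
move=> idI; have [sw [swC swE]] := mpoly_swap.
have extE h : ext h = map_mpoly j (map_mpoly (@mpolyC m K) h).
  by apply/mpolyP => u; rewrite !mcoeff_map_mpoly.
have -> : ext = map_mpoly j \o map_mpoly (@mpolyC m K) by apply/funext => h; exact: extE.
apply: (ext_ideal_contract_gen (sw := sw) (W := [set d%:MP | d in [set d : D | d != 0]])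
  (J := [set s | forall v, I s@_v])).
- move=> s t /mpolyP est; apply/mpolyP => u; apply: j_inj.
  by move: (est u); rewrite !mcoeff_map_mpoly.
- by exists 1; rewrite /= ?oner_neq0.
- move=> _ _ [d d0 <-] [e e0 <-]; exists (d * e); first by rewrite /= mulf_neq0.
  by rewrite mpolyCM.
- move=> r; have [d d0 [r' er]] := mpoly_common_denom denom r.
  by exists d%:MP; [exists d|exists r'; rewrite /= map_mpolyC mul_mpolyC].
- exact: coef_ideal.
- by move=> h Ih v; rewrite swE mcoeffC; apply: ideal_mulr.
move=> _ [d d0 <-]; rewrite rmorphM swC swE => Jf.
(* A nonzero d in K[z] has a coefficient d_v that is a unit of K, and the coefficient of d f at z^v
   is d_v f. *)
have /existsNP[v /eqP dv] : ~ forall v, d@_v = 0.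
  by move=> dv; case/eqP: d0; apply/mpolyP => v; rewrite mcoeff0.
have [_ _ IM] := idI; move: (IM (d@_v)^-1%:MP _ (Jf v)).
rewrite [map_mpoly _ _ * _]mulrC (mul_mpolyC f) mcoeffZ mcoeff_map_mpoly /=.
by rewrite mulrCA -mpolyCM mulVf // mulr1.
Qed.

End Contraction.

(** * Frobenius roots of powers of the generic combination *)

Section GenericPower.
Variables (p : nat) (g : 'I_m -> {mpoly K[n]}).
Hypotheses (hp : p \in [pchar K]) (hK : F_finite p K).
Hypothesis hF : forall q (I : finType) (b : I -> D),
  [pchar K].-nat q -> frob_basis q b -> frob_basis q (fun i => j (b i)).
Local Notation G := (\sum_(i < m) j 'X_i *: ext (g i)).
Local Notation a := (ideal_gen (range g)).

Lemma rmorph_mpolyX (v : 'X_{1..m}) : \prod_i j 'X_i ^+ v i = j 'X_[v].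
Proof.
by rewrite mpolyXE_id rmorph_prod; apply: eq_bigr => i _; rewrite rmorphXn.
Qed.

Lemma generic_sum_expr k : G ^+ k =
  mmap (@mpolyC n F \o (j \o @mpolyC m K)) (fun i => j 'X_i *: ext (g i))
    (sumX K m ^+ k).
Proof.
rewrite rmorphXn; congr (_ ^+ _); rewrite raddf_sum.
by apply: eq_bigr => i _ /=; rewrite mmapX mmap1U.
Qed.

Lemma mmap1_generic v :
  mmap1 (fun i => j 'X_i *: ext (g i)) v = j 'X_[v] *: ext (mmap1 g v).
Proof.
rewrite -rmorph_mpolyX /mmap1 rmorph_prod.
elim/big_rec3: _ => [|i x y z _ ->]; first by rewrite scale1r.
by rewrite exprZn rmorphXn -scalerAl -scalerAr scalerA.
Qed.

Lemma frob_root_generic e k : (k < p ^ e)%N ->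
  frob_root (ideal_pow (ideal_gen [set G]) k) (p ^ e) =
  ext_ideal ext (frob_root (frob_nat p a k) (p ^ e)).
Proof.
move=> ltkq; have hq : [pchar K].-nat (p ^ e)%N by exact: pchar_expn.
have [r [b bK]] := F_finite_frob_basis e hp hK.
set q := (p ^ e)%N in ltkq hq bK *.
have bS := mpoly_frob_basis n hq bK.
have bF := hF hq (mpoly_frob_basis m hq bK).
have hqS : [pchar {mpoly K[n]}].-nat q by exact: pchar_mpoly.
have hqF : [pchar F].-nat q.
  apply: sub_in_pnat hq => l _; exact: (rmorph_pchar (j \o @mpolyC m K)).
have bT := mpoly_frob_basis n hqF bF.
have hqT : [pchar {mpoly F[n]}].-nat q by exact: pchar_mpoly.
have hpS : p \in [pchar {mpoly K[n]}] by exact: (rmorph_pchar (@mpolyC n K)).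
have [h hE] := choice (fun v : 'X_{1..m} => bS.1 (mmap1 g v)).
have Eq v : v \in msupp (sumX K m ^+ k) -> forall i, (v i < q)%N.
  by move=> /mdeg_msupp_sumX dv i; apply: leq_ltn_trans ltkq; rewrite -dv mnm_le_mdeg.
rewrite (frob_nat_range hp) // (frob_root_gen hqS bS (h := h)) => [|v _]; last exact: hE.
rewrite ext_ideal_gen ideal_pow_set1.
pose c v : K := (sumX K m ^+ k)@_v.
(* The coordinate of G^k at b_l z^v x^w. All v with entries below q are listed; those outside the
   support give 0. *)
pose H (_ : unit) (i : ('I_r * {ffun 'I_m -> 'I_q}) * {ffun 'I_n -> 'I_q}) :=
  ext (c (mnm_of_ffun i.1.2) *: h (mnm_of_ffun i.1.2) (i.1.1, i.2)).
have -> : [set G ^+ k] = (fun _ : unit => G ^+ k) @` setT.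
  by apply/seteqP; split=> [_ ->|_ [_ _ <-]] //; exists tt.
rewrite (frob_root_gen hqT bT (h := H)); last first.
  move=> [] _; rewrite generic_sum_expr {1}(mpoly_sum_ffun Eq) raddf_sum /=.
  transitivity (\sum_(v : {ffun 'I_m -> 'I_q}) \sum_(l : 'I_r) \sum_(w : {ffun 'I_n -> 'I_q})
     H tt ((l, v), w) ^+ q *
       ((j ((b l)%:MP_[m] * 'X_[mnm_of_ffun v]))%:MP_[n] * 'X_[mnm_of_ffun w])).
    apply: eq_bigr => v _; rewrite mmapZ mmapX mmap1_generic /= hE -/(c _).
    rewrite (raddf_sum (map_mpoly (j \o @mpolyC m K))).
    rewrite scaler_sumr mulr_sumr pair_bigA /=.
    apply: eq_bigr => -[l w] _ /=; rewrite /H /=; set hv := h _ _.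
    (* The coefficient c_v is its own q-th power, hence can be moved into the coordinate. *)
    have -> : ext (c (mnm_of_ffun v) *: hv) ^+ q = ext (c (mnm_of_ffun v) *: hv ^+ q).
      by rewrite -rmorphXn exprZn /c sumX_coef_frob.
    rewrite map_mpolyZ !(rmorphM (map_mpoly _)) /= map_mpolyX map_mpolyC /=.
    rewrite (rmorphM j) mpolyCM -!mul_mpolyC -[RHS]mulrA; congr (_ * _).
    by rewrite mulrCA -[in RHS]mulrA; congr (_ * _); rewrite mulrCA.
  rewrite exchange_big pair_bigA pair_bigA /=.
  by apply: eq_bigr => -[[l v] w].
apply/seteqP; split; apply: ideal_gen_min; try exact: ideal_gen_ideal.
  move=> _ [[] [[[l v] w] [_ ->]]]; rewrite /H /=.
  have [v0|v0] := boolP (mnm_of_ffun v \in msupp (sumX K m ^+ k)); last first.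
    rewrite /c memN_msupp_eq0 // scale0r rmorph0.
    by case: (ideal_gen_ideal (ext @` [set x | exists v i,
      v \in msupp (sumX K m ^+ k) /\ x = h v i])).
  rewrite map_mpolyZ -mul_mpolyC.
  have [_ _] := ideal_gen_ideal (ext @` [set x | exists v i,
      v \in msupp (sumX K m ^+ k) /\ x = h v i]); apply.
  apply: sub_ideal_gen; exists (h (mnm_of_ffun v) (l, w)) => //.
  by exists (mnm_of_ffun v), (l, w).
move=> _ [_ [v [[l w] [vE ->]] <-]].
have [_ _ IM] := ideal_gen_ideal [set x | exists v i, [set: unit] v /\ x = H v i].
have c0 : c v != 0 by rewrite -mcoeff_msupp.
(* The entries of v are at most its degree k < q, so z^v is one of the basis monomials. *)
pose f : {ffun 'I_m -> 'I_q} := [ffun i => Ordinal (Eq v vE i)].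
have fE : mnm_of_ffun f = v by apply/mnmP => i; rewrite mnmE ffunE.
rewrite /=; have -> : ext (h v (l, w)) = ext ((c v)^-1)%:MP * H tt ((l, f), w).
  by rewrite /H /= fE -rmorphM mul_mpolyC scalerA mulVf // scale1r.
by apply: IM; apply: sub_ideal_gen; exists tt, ((l, f), w).
Qed.

(** For q = p^e, g_i^q is a multiple of g_i^k, an element of a^[k]; so g_i^q lies in c^[q] as soon
    as a^[k] does, and then g_i lies in c. *)
Lemma ideal_range_frob_root e k : (k <= p ^ e)%N ->
  a `<=` frob_root (frob_nat p a k) (p ^ e).
Proof.
move=> lekq; have hq : [pchar K].-nat (p ^ e)%N by exact: pchar_expn.
have [r [b bK]] := F_finite_frob_basis e hp hK.
have hqS : [pchar {mpoly K[n]}].-nat (p ^ e)%N by exact: pchar_mpoly.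
have hpS : p \in [pchar {mpoly K[n]}] by exact: (rmorph_pchar (@mpolyC n K)).
apply: ideal_gen_min => [|_ [i _ <-] c idc ac]; first exact: frob_root_ideal.
apply: (frob_expr_mem hqS (mpoly_frob_basis n hq bK)) => //.
have -> : g i ^+ (p ^ e) = g i ^+ (p ^ e - k) * g i ^+ k by rewrite -exprD subnK.
have [_ _ M] := frob_ideal c (p ^ e); apply: M.
apply: ac; rewrite (frob_nat_range hp) //; apply: sub_ideal_gen.
exists (U_(i) *+ k)%MM; last by rewrite mmap1Mn mmap1U.
exact: (sumX_pure_power hp).
Qed.

(** * Real exponents and thresholds *)

Section RealExponent.
Variable R : realType.
Implicit Type t : R.
Hypotheses (j_inj : injective j)
  (denom : forall x, exists2 d, d != 0 & exists a, x * j d = j a).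
Local Notation tauG t := (test_ideal p (ideal_gen [set G]) t).

Let p1 : (1 < p)%N := prime_gt1 (pcharf_prime hp).

(** Both unions are restricted to the set E of levels with exponent below p^e, where
    [frob_root_generic] compares them term by term. *)
Lemma test_ideal_generic t : 0 < t < 1 ->
  tauG t = ext_ideal ext (frob_real p a t) /\ frob_real p a t = ext @^-1` tauG t.
Proof.
case/andP=> t0 t1.
pose k e := ceil_scale p t e.
pose J e := frob_root (frob_nat p a (k e)) (p ^ e).
pose L e := frob_root (ideal_pow (ideal_gen [set G]) (k e)) (p ^ e).
pose E := [set e | (k e < p ^ e)%N].
have LE e : E e -> L e = ext_ideal ext (J e) by exact: frob_root_generic.
have [e0 Ee0] := ceil_scale_lt_ex p1 t0 t1.
have incL e : L e `<=` L e.+1.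
  have hq : [pchar K].-nat p by have := pchar_expn hp 1.
  have [r [b bK]] := F_finite_frob_basis 1 hp hK.
  have bF := hF hq (mpoly_frob_basis m hq bK).
  have hqF : [pchar F].-nat p.
    apply: sub_in_pnat hq => l _; exact: (rmorph_pchar (j \o @mpolyC m K)).
  exact: (frob_root_pow_step (pchar_mpoly n hqF) (mpoly_frob_basis n hqF bF)
    (ceil_scaleS p t0 e)).
have ES e : E e -> E e.+1.
  rewrite /E /= => Ee; apply: leq_ltn_trans (ceil_scaleS p t0 e) _.
  by rewrite expnS ltn_pmul2l // ltnW.
have tauE : tauG t = \bigcup_(e in E) ext_ideal ext (J e).
  apply/seteqP; split=> [x [e _ Lx]|x [e Ee Jx]]; last first.
    by exists e => //; rewrite -/(L e) LE.
  have addE l : E (l + e0)%N by elim: l => // l; exact: ES.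
  have addL l : L (l + e)%N x by elim: l => // l; exact: incL.
  (* This level is in E because it is above e0, and its root contains x because it is above e. *)
  by exists (e + e0)%N; [exact: addE | rewrite -LE // addnC; exact: addL].
have realE : frob_real p a t = \bigcup_(e in E) J e.
  apply/seteqP; split=> [x [e _ Jx]|x [e Ee Jx]]; last by exists e.
  have [Ee|nEe] := boolP (k e < p ^ e)%N; first by exists e.
  (* Outside E the exponent is at least p^e, so the term lies in a, and a lies in the term at e0. *)
  exists e0 => //; apply: ideal_range_frob_root; first exact: ltnW.
  apply: Jx; first exact: ideal_gen_ideal.
  by apply: frob_nat_sub => //; [exact: ideal_gen_ideal | rewrite leqNgt].
have idtau : is_ideal (tauG t) by apply: bigcup_ideal => // e; exact: frob_root_ideal.
split; first by rewrite realE ext_ideal_bigcup ?tauE // -tauE.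
rewrite tauE realE; apply/seteqP; split=> x [e Ee Jx]; exists e => //.
  exact: mem_ext_ideal.
by apply: (ext_ideal_contract j_inj denom) => //; exact: frob_root_ideal.
Qed.

Lemma fpt_generic : a <> setT -> fpt R p (ideal_gen [set G]) = lce R p a.
Proof.
move=> aT; congr sup; apply/seteqP; split=> t [t0 tT]; split=> //.
- have [t1|t1] := ltP t 1.
    have [_ ->] : _ /\ _ := test_ideal_generic (introT andP (conj t0 t1)).
    by rewrite tT preimage_setT.
  (* For t >= 1 each term of the test ideal lies in the ideal of G, hence in the extension of a; if
     1 were there, contraction would put 1 in a. *)
  case: aT; apply: ideal_1; first exact: ideal_gen_ideal.
  apply: (ext_ideal_contract j_inj denom); first exact: ideal_gen_ideal.
  have : [set: {mpoly F[n]}] (ext 1) by [].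
  rewrite -tT => -[e _ Le].
  have : ideal_gen [set G] (ext 1).
    apply: Le; first exact: ideal_gen_ideal.
    rewrite ideal_pow_set1; apply: ideal_gen_min => [|_ ->]; first exact: frob_ideal.
    rewrite -(subnK (ceil_scale_ge p1 t0 e t1)) exprD.
    have [_ _ M] := frob_ideal (ideal_gen [set G]) (p ^ e); apply: M.
    by apply: mem_frob; apply: sub_ideal_gen.
  apply: ideal_gen_min => [|_ ->]; first exact: ideal_gen_ideal.
  have idE : is_ideal (ext_ideal ext a) by exact: ideal_gen_ideal.
  apply: (ideal_sum _ idE) => i _; rewrite -mul_mpolyC.
  have [_ _ M] := idE; apply: M; apply: mem_ext_ideal.
  by apply: sub_ideal_gen; exists i.
- have [t1|t1] := ltP t 1.
    have [-> _] : _ /\ _ := test_ideal_generic (introT andP (conj t0 t1)).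
    rewrite tT; apply: ideal_1; first exact: ideal_gen_ideal.
    by rewrite -(rmorph1 ext); apply: mem_ext_ideal.
  (* For t >= 1 each term of a^[t] lies in a, since its exponent is at least p^e. *)
  case: aT; apply/seteqP; split=> // x _.
  have : frob_real p a t x by rewrite tT.
  case=> e _; apply; first exact: ideal_gen_ideal.
  apply: frob_nat_sub => //; first exact: ideal_gen_ideal.
  exact: ceil_scale_ge.
Qed.

End RealExponent.
End GenericPower.
End GenericField.

Theorem corollary5p7 (R : realType) (K : fieldType) (p n m : nat)
    (g : 'I_m -> {mpoly K[n]}) :
  p \in [pchar K] -> F_finite p K ->
  let a : set {mpoly K[n]} := ideal_gen (range g) in
  let tauG (t : R) : set {mpoly (ratfun K m)[n]} :=
    test_ideal p (ideal_gen [set generic_comb g]) t in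
  (forall t : R, 0 < t < 1 ->
     tauG t = ext_ideal (ratfun_ext m) (frob_real p a t) /\
     frob_real p a t = ratfun_ext m @^-1` tauG t) /\
  (a <> [set 0] -> a <> setT ->
     fpt R p (ideal_gen [set generic_comb g]) = lce R p a).
Proof.
move=> hp hK a tauG.
(* For this j, the local [ext] and [G] are convertible to [ratfun_ext] and [generic_comb]. *)
pose j : {rmorphism {mpoly K[m]} -> ratfun K m} := @tofrac {mpoly K[m]}.
have j_inj : injective j by move=> x y /eqP; rewrite tofrac_eq => /eqP.
have denom : forall x : ratfun K m, exists2 d, d != 0 & exists a, x * j d = j a.
  exact: (@fraction_denom {mpoly K[m]}).
have hF : forall q (I : finType) (b : I -> {mpoly K[m]}),
    [pchar K].-nat q -> frob_basis q b -> frob_basis q (fun i => j (b i)).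
  by move=> q I b hq; apply: fraction_frob_basis; exact: pchar_mpoly.
split; first exact: (@test_ideal_generic K m n (ratfun K m) j p g hp hK hF R j_inj denom).
move=> _; exact: (@fpt_generic K m n (ratfun K m) j p g hp hK hF R j_inj denom).
Qed.
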